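(* Let $\Delta$ be a simplicial complex on the vertex set $X=\{x_1,\dots,x_n\}$. Then $$\dim\mathbb{K}[\Delta]\ge\omega(I_{\Delta})-1.$$ The equality $\dim\mathbb{K}[\Delta]=\omega(I_\Delta)-1$ holds if and only if $I_{\Delta}$ has a degree resolution and $\operatorname{reg}\mathbb{K}[\Delta]=\dim\mathbb{K}[\Delta]$.
   Context: Let $n>0$, $X=\{x_1,\dots,x_n\}$, $\mathbb{K}$ a field and $R=\mathbb{K}[x_1,\dots,x_n]$. A simplicial complex $\Delta$ on $X$ is a collection of subsets of $X$ (called faces), closed under taking subsets and containing every singleton $\{x_i\}$. The Stanley-Reisner ideal $I_\Delta\subseteq R$ is generated by the monomials $\prod_{x_i\in N}x_i$ with $N$ a minimal (with respect to inclusion) non-face of $\Delta$, and $\mathbb{K}[\Delta]=R/I_\Delta$. The dimension $\dim\mathbb{K}[\Delta]$ is the Krull dimension. For a monomial ideal $I\subseteq R$ with set of minimal monomial generators $\mathcal{G}(I)$, the degree of $I$ is $\omega(I)=\max\{\deg(u)\mid u\in\mathcal{G}(I)\}$. The graded Betti number $\beta_{i,j}(M)$ is the number of minimal generators of degree $j$ in homological position $i$ of the minimal graded free resolution of $M$ over $R$, and $\operatorname{reg}M=\max\{j-i\mid\beta_{i,j}(M)\ne0\}$ is the Castelnuovo-Mumford regularity. A monomial ideal $I\subseteq R$ has a degree resolution if $\beta_{i,j}(I)=0$ for all $i\ge0$ and $j>i+\omega(I)$; equivalently, $\operatorname{reg}I=\omega(I)$. *)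

(* Defs.v *)
From HB Require Import structures.
From mathcomp Require Import all_boot all_order all_algebra.
From mathcomp Require Import generic_quotient ring_quotient.
From mathcomp Require Import boolp mpoly.

Set Implicit Arguments.
Unset Strict Implicit.
Unset Printing Implicit Defensive.

Import Order.TTheory GRing.Theory Num.Theory.
Local Open Scope ring_scope.
Local Open Scope quotient_scope.

(* Sets without a maximum get the value 0: in particular omega of the zero
   ideal, which has no generators, is 0. *)
Definition max_int (S : int -> Prop) : int :=
  match pselect (exists m, S m /\ forall k, S k -> k <= m) with
  | left ex => projT1 (cid ex)
  | right _ => 0
  end.

(* P 0 < P 1 < ... < P d; idealr_closed includes properness. *)
Definition prime_chain (A : comNzRingType) (d : nat)
    (P : 'I_d.+1 -> {pred A}) : Prop :=
  (forall i, idealr_closed (P i) /\ prime_idealr_closed (P i)) /\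
  (forall i j : 'I_d.+1, (i < j)%N ->
     {subset P i <= P j} /\ exists2 x, x \in P j & x \notin P i).

Definition krull_dim (A : comNzRingType) : int :=
  max_int (fun k => exists d (P : 'I_d.+1 -> {pred A}),
                      prime_chain P /\ k = d%:Z).

Definition ideal_gen (R : comNzRingType) (S : R -> Prop) : {pred R} :=
  fun p => `[< exists s : seq (R * R),
      (forall g, g \in s -> S g.2) /\ p = \sum_(g <- s) g.1 * g.2 >].

Section IdealModules.
Variables (R : comNzRingType) (I : idealr R).

Definition ideal_pred : {pred R^o} := (I : R -> bool).

Fact ideal_pred_closed : submod_closed ideal_pred.
Proof.
split=> [|a x y xI yI]; first exact: (rpred0 I).
by apply: (rpredD (S := I)) => //; apply: (idealMr (idealrI := I)).
Qed.

HB.instance Definition _ :=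
  GRing.isSubmodClosed.Build R R^o ideal_pred ideal_pred_closed.

Definition ideal_mod : Type := {x : R^o | x \in ideal_pred}.
HB.instance Definition _ := SubChoice.on ideal_mod.
HB.instance Definition _ := [SubChoice_isSubLmodule of ideal_mod by <:].

Definition quot_mod : Type := {ideal_quot I}.
HB.instance Definition _ := GRing.Zmodule.on quot_mod.

Definition quot_scale (a : R) (x : quot_mod) : quot_mod :=
  (\pi_({ideal_quot I}) a * x : {ideal_quot I}).

Fact quot_scaleA a b x : quot_scale a (quot_scale b x) = quot_scale (a * b) x.
Proof. by rewrite /quot_scale mulrA rmorphM. Qed.
Fact quot_scale1 : left_id 1 quot_scale.
Proof. by move=> x; rewrite /quot_scale rmorph1 mul1r. Qed.
Fact quot_scaleDr : right_distributive quot_scale +%R.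
Proof. by move=> a x y; rewrite /quot_scale mulrDr. Qed.
Fact quot_scaleDl x : {morph quot_scale^~ x : a b / a + b}.
Proof. by move=> a b; rewrite /quot_scale rmorphD mulrDl. Qed.

HB.instance Definition _ := GRing.Zmodule_isLmodule.Build R quot_mod
  quot_scaleA quot_scale1 quot_scaleDr quot_scaleDl.

End IdealModules.

Section Betti.
Variables (K : fieldType) (n : nat).
Local Notation R := {mpoly K[n]}.

(* A nonnegatively graded R-module is given by M together with hom, where
   hom d is the homogeneous component of degree d. *)
Section Resolution.
Variables (M : lmodType R) (hom : nat -> M -> Prop).

(* The free module in position i is the space of row vectors R^(rk i), whose
   r-th basis vector has degree dg i r; the map from position i.+1 to position
   i is v |-> v *m df i, and aug lists the images in M of the basis in
   position 0. *)
Record free_complex := FreeComplex {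
  rk : nat -> nat;
  dg : forall i, 'I_(rk i) -> nat;
  df : forall i, 'M[R]_(rk i.+1, rk i);
  aug : 'I_(rk 0) -> M
}.

Definition aug_map (F : free_complex) (v : 'rV[R]_(rk F 0)) : M :=
  \sum_(c < rk F 0) v ord0 c *: aug c.

Definition is_graded (F : free_complex) : Prop :=
  (forall c : 'I_(rk F 0), hom (dg c) (aug c)) /\
  (forall i (r : 'I_(rk F i.+1)) (c : 'I_(rk F i)),
     ((dg c <= dg r)%N -> df F i r c \is (dg r - dg c).-homog) /\
     ((dg r < dg c)%N -> df F i r c = 0)).

Definition is_resolution (F : free_complex) : Prop :=
  [/\ forall m : M, exists v : 'rV_(rk F 0), aug_map v = m,
      forall v : 'rV_(rk F 0), aug_map v = 0 <-> exists w, v = w *m df F 0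
    & forall i (v : 'rV_(rk F i.+1)), v *m df F i = 0 <-> exists w, v = w *m df F i.+1].

(* The image of each df lies in (x_1, ..., x_n) times its target. *)
Definition is_minimal (F : free_complex) : Prop :=
  forall i r c, (df F i r c)@_0%MM = 0.

Definition min_graded_resolution (F : free_complex) : Prop :=
  [/\ is_graded F, is_resolution F & is_minimal F].

(* Any two minimal graded free resolutions are isomorphic, so the chosen one is
   irrelevant; one exists whenever M is finitely generated. *)
Definition betti (i j : nat) : nat :=
  match pselect (exists F, min_graded_resolution F) with
  | left ex => let F := projT1 (cid ex) in #|[pred r : 'I_(rk F i) | dg r == j]|
  | right _ => 0
  end.

Definition reg : int :=
  max_int (fun k => exists i j, betti i j <> 0%N /\ k = j%:Z - i%:Z).

End Resolution.

Variable I : idealr R.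

Definition ideal_hom (d : nat) (x : ideal_mod I) : Prop :=
  (val x : R) \is d.-homog.

Definition quot_hom (d : nat) (x : quot_mod I) : Prop :=
  exists2 p : R, p \is d.-homog & x = \pi_({ideal_quot I}) p.

End Betti.

Section MonomialIdeals.
Variables (K : fieldType) (n : nat).
Local Notation R := {mpoly K[n]}.

Definition generates (G : 'X_{1..n} -> Prop) (I : {pred R}) : Prop :=
  I =i ideal_gen (fun p : R => exists2 m, G m & p = 'X_[m]).

Definition min_monomial_gens (G : 'X_{1..n} -> Prop) (I : {pred R}) : Prop :=
  generates G I /\
  forall G' : 'X_{1..n} -> Prop, (forall m, G' m -> G m) -> generates G' I ->
    forall m, G m -> G' m.

Definition omega (I : {pred R}) : int :=
  max_int (fun k => exists G m,
                      [/\ min_monomial_gens G I, G m & k = (mdeg m)%:Z]).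

Definition degree_resolution (I : idealr R) : Prop :=
  forall i j : nat, j%:Z > i%:Z + omega I -> betti (@ideal_hom K n I) i j = 0%N.

End MonomialIdeals.

(* For n > 0 the condition faces0 follows from the other two; it makes the
   Stanley-Reisner ideal proper for all n. *)
Record simplicial_complex (n : nat) := SimplicialComplex {
  faces : {set {set 'I_n}};
  faces0 : set0 \in faces;
  faces1 : forall i, [set i] \in faces;
  facesS : forall A B : {set 'I_n}, A \subset B -> B \in faces -> A \in faces
}.

Section StanleyReisner.
Variables (K : fieldType) (n : nat) (D : simplicial_complex n).
Local Notation R := {mpoly K[n]}.

Definition SR_pred : {pred R} :=
  ideal_gen (fun p : R => exists2 N : {set 'I_n},
    minset (fun A => A \notin faces D) N & p = \prod_(i in N) 'X_i).

Fact SR_closed : idealr_closed SR_pred.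
Proof.
split.
- by apply/asboolP; exists [::]; rewrite big_nil.
- apply/asboolP=> -[s [sN /(congr1 (mcoeff 0))]].
  rewrite mcoeff1 eqxx raddf_sum big_seq big1 /=; last first.
    move=> g /sN[N /minsetP[Nn _] ->].
    case: (set_0Vmem N) => [N0|[x xN]].
      by rewrite N0 (faces0 D) in Nn.
    by rewrite (bigD1 x) //= !rmorphM /= mcoeffX mnm1_eq0 mul0r mulr0.
  by move/eqP; rewrite oner_eq0.
- move=> a x y /asboolP[s [sN ->]] /asboolP[t [tN ->]]; apply/asboolP.
  exists ([seq (a * g.1, g.2) | g <- s] ++ t); split=> [g|].
    rewrite mem_cat => /orP[/mapP[h /sN hN -> //]|]; exact: tN.
  rewrite big_cat big_map /= mulr_sumr; congr (_ + _).
  by apply: eq_bigr => g _; rewrite mulrA.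
Qed.

HB.instance Definition _ := isIdealr.Build R SR_pred SR_closed.

Definition SR_ideal : idealr R := SR_pred.

Definition SR_ring : comNzRingType := {ideal_quot SR_ideal}.

Definition SR_reg : int := reg (@quot_hom K n SR_ideal).

End StanleyReisner.

(* Main.v *)
(* A minimal graded free resolution of K[D] can be built from squarefree data
   alone: basis elements are labelled by sets W and the entry from r to c is a
   scalar times x^(W r \ W c), so exactness is a condition on the complexes of
   K-vector spaces {r | W r \subset A}, A a set of variables. The filtration of
   these complexes by {r | L \subset W r} gives long exact sequences which show,
   by induction on L, that a minimal generator in position i satisfies
   W r \ S \in D for some S \subset W r with i elements; hence its degree is at
   most i + max |F|, F a face of D. Minimal resolutions have the same generator
   degrees, so reg K[D] <= max |F|, and deleting position 0 resolves I_D. A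
   minimal nonface of maximal size omega is a generator of degree omega in
   position 1, and removing a vertex from it leaves a face, whence
   omega - 1 <= max |F| <= dim K[D]. The exact value of dim K[D] is not used:
   prime chains through faces bound it from below, and n + 1 polynomials in n
   variables being algebraically dependent shows that it is not a junk value. *)

From HB Require Import structures.
Require Import Defs.
From mathcomp Require Import all_boot all_order all_algebra.
From mathcomp Require Import generic_quotient ring_quotient.
From mathcomp Require Import boolp mpoly zify.

Set Implicit Arguments.
Unset Strict Implicit.
Unset Printing Implicit Defensive.

Import Order.TTheory GRing.Theory Num.Theory.
Local Open Scope ring_scope.
Local Open Scope quotient_scope.

(** * Linear algebra of squarefree complexes *)

Section SquarefreeLinearAlgebra.
Variables (K : fieldType) (T : finType).

(** The rows within [A] form the strand of the complex seen in every multidegree with support [A].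
    Exactness is tested on these finite-dimensional spaces. *)
Definition row_within k (W : 'I_k -> {set T}) (A : {set T}) (u : 'rV[K]_k) :=
  forall r, u 0 r != 0 -> W r \subset A.

Definition downward k k' (W : 'I_k -> {set T}) (W' : 'I_k' -> {set T})
    (C : 'M[K]_(k', k)) :=
  forall r c, C r c != 0 -> W c \subset W' r.

Definition irredundant k k' (W' : 'I_k' -> {set T}) (C : 'M[K]_(k', k)) :=
  forall A t, row_within W' A t -> t *m C = 0 ->
    forall r, W' r = A -> t 0 r = 0.

Definition syzygies k k' k0 (W : 'I_k -> {set T}) (W' : 'I_k' -> {set T})
    (C : 'M[K]_(k', k)) (C0 : 'M[K]_(k, k0)) :=
  [/\ downward W W' C, C *m C0 = 0 &
      forall A u, row_within W A u -> u *m C0 = 0 ->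
        exists2 w, row_within W' A w & u = w *m C].

Lemma row_withinB k (W : 'I_k -> {set T}) A u v :
  row_within W A u -> row_within W A v -> row_within W A (u - v).
Proof.
move=> hu hv r; rewrite !mxE.
have [u0|/hu//] := eqVneq (u 0 r) 0.
by rewrite u0 sub0r oppr_eq0 => /hv.
Qed.

Lemma row_within_mul k k' (W : 'I_k -> {set T}) (W' : 'I_k' -> {set T}) C A u :
  downward W W' C -> row_within W' A u -> row_within W A (u *m C).
Proof.
move=> hC hu c; apply: contraNT => hc; rewrite mxE big1 // => r _.
apply/eqP; rewrite mulf_eq0; apply: contraNT hc; rewrite negb_or.
by case/andP=> /hu h /hC h'; apply: subset_trans h' h.
Qed.

(** There are finitely many sets [A]: for each, take a spanning family of the cycles within [A] and
    label all of it by [A]. The block [outside A] turns the support condition into a linear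
    equation. *)
Lemma exists_syzygies k k0 (W : 'I_k -> {set T}) (C0 : 'M[K]_(k, k0)) :
  exists k' (W' : 'I_k' -> {set T}) (C : 'M[K]_(k', k)), syzygies W W' C C0.
Proof.
pose outside (A : {set T}) : 'M[K]_k := diag_mx (\row_c (W c \subset A == false)%:R).
pose N A := kermx (row_mx C0 (outside A)).
have outE A (u : 'rV_k) c : (u *m outside A) 0 c = u 0 c * (~~ (W c \subset A))%:R.
  by rewrite mul_mx_diag !mxE eqbF_neg.
have inN A (u : 'rV_k) : row_within W A u -> u *m C0 = 0 -> (u <= N A)%MS.
  move=> hu hC; apply/sub_kermxP; rewrite mul_mx_row hC; apply/eqP.
  rewrite row_mx_eq0 eqxx /=; apply/eqP/rowP=> c; rewrite outE mxE.
  have [->|/hu->] := eqVneq (u 0 c) 0; first by rewrite mul0r.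
  by rewrite mulr0.
have Nin A (u : 'rV_k) : (u <= N A)%MS -> row_within W A u /\ u *m C0 = 0.
  move/sub_kermxP; rewrite mul_mx_row => /eqP; rewrite row_mx_eq0.
  case/andP=> /eqP-> /eqP h; split=> // c; apply: contraNT => hc.
  by move/rowP: h => /(_ c); rewrite outE hc mulr1 mxE => ->.
pose I := ({set T} * 'I_k)%type.
pose W' (r : 'I_#|{: I}|) := (enum_val r).1.
pose C : 'M[K]_(#|{: I}|, k) :=
  \matrix_r row (enum_val r).2 (N (enum_val r).1).
exists #|{: I}|, W', C; split.
- move=> r c; have [h _] := Nin _ _ (row_sub (enum_val r).2 (N (W' r))).
  by move=> hc; apply: h; move: hc; rewrite !mxE.
- apply/row_matrixP=> r; rewrite row_mul row0 rowK.
  by have [] := Nin _ _ (row_sub (enum_val r).2 (N (W' r))).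
move=> A u hu /(inN _ _ hu)/submxP[w ->].
pose w' : 'rV_#|{: I}| :=
  \row_r (if (enum_val r).1 == A then w 0 (enum_val r).2 else 0).
exists w'; first by move=> r; rewrite mxE /W'; case: (_.1 =P A) => [->|]; rewrite ?eqxx.
rewrite mulmx_sum_row [RHS]mulmx_sum_row.
pose F (p : I) := (if p.1 == A then w 0 p.2 else 0) *: row p.2 (N p.1).
rewrite [RHS](eq_bigr (fun r => F (enum_val r))) => [|r _]; last by rewrite mxE rowK.
rewrite -(big_enum_val F) /=.
rewrite /F -(pair_bigA _ (fun a j => (if a == A then w 0 j else 0) *: row j (N a))) /=.
rewrite (bigD1 A) //= [X in _ = _ + X]big1 ?addr0; last first.
  by move=> B /negPf->; rewrite big1 // => j _; rewrite scale0r.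
by apply: eq_bigr => j _; rewrite eqxx.
Qed.

(** A system with the fewest rows is irredundant: a relation within [A] with nonzero coefficient at
    a row labelled exactly [A] expresses that row through others with labels inside [A], so the row
    could be dropped. *)
Lemma exists_irredundant_syzygies k k0 (W : 'I_k -> {set T}) (C0 : 'M[K]_(k, k0)) :
  exists k' (W' : 'I_k' -> {set T}) (C : 'M[K]_(k', k)),
    syzygies W W' C C0 /\ irredundant W' C.
Proof.
pose P k' := `[< exists (W' : 'I_k' -> {set T}) (C : 'M[K]_(k', k)),
  syzygies W W' C C0 >].
have exP : exists k', P k'.
  have [k' [W' [C h]]] := exists_syzygies W C0.
  by exists k'; apply/asboolP; exists W', C.
have [[|k'] /asboolP[W' [C hC]] kmin] := ex_minnP exP.
  by exists 0, W', C; split=> // ? ? ? ? [].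
exists k'.+1, W', C; split=> // A t ht tC r rA; apply/eqP/negPn/negP => tr.
suff /kmin : P k' by rewrite ltnn.
case: hC => hC CC0 gen.
apply/asboolP; exists (W' \o lift r), (row' r C); split.
- by move=> i c; rewrite mxE; apply: hC.
- apply/row_matrixP=> i; rewrite row_mul row0.
  have -> : row i (row' r C) = row (lift r i) C by apply/rowP=> j; rewrite !mxE.
  by rewrite -row_mul CC0 row0.
move=> B u hu /(gen _ _ hu)[w hw ->].
(* This clears the coefficient at [r]. If it was nonzero, then [A] lies in [B], so the labels of [t]
   stay inside [B]. *)
pose w1 := w - (w 0 r / t 0 r) *: t.
have w1r : w1 0 r = 0 by rewrite !mxE divfK ?subrr.
have hw1 : row_within W' B w1.
  have [w0|wr] := eqVneq (w 0 r) 0; first by rewrite /w1 w0 mul0r scale0r subr0.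
  apply: row_withinB => // i; rewrite mxE mulf_eq0 negb_or => /andP[_ /ht h].
  by rewrite -rA in h; apply: subset_trans h (hw _ wr).
exists (\row_i w1 0 (lift r i)); first by move=> i; rewrite mxE; apply: hw1.
have -> : w *m C = w1 *m C by rewrite mulmxBl -scalemxAl tC scaler0 subr0.
rewrite mulmx_sum_row [RHS]mulmx_sum_row (bigD1_ord r) //= w1r scale0r add0r.
apply: eq_bigr => i _; rewrite mxE; congr (_ *: _).
by apply/rowP=> j; rewrite !mxE.
Qed.

(** * A bound on the labels of minimal generators *)

Section Bound.
Variables (k : nat -> nat) (W : forall i, 'I_(k i) -> {set T}).
Variable C : forall i, 'M[K]_(k i.+1, k i).
Variable nonface : {set T} -> Prop.
Hypothesis C_syz : forall i, syzygies (@W i.+1) (@W i.+2) (C i.+1) (C i).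
Hypothesis C0_down : downward (@W 0) (@W 1) (C 0).
Hypothesis C0_surj : forall A u, nonface A -> row_within (@W 0) A u ->
  exists2 w, row_within (@W 1) A w & u = w *m C 0.
Hypothesis C_min : forall i r c, W c = W r -> C i r c = 0.

Let C_down i : downward (@W i) (@W i.+1) (C i).
Proof. by case: i => // i; have [] := C_syz i. Qed.

(** A cycle modulo the span of the labels that do not contain [L], which [downward] makes a
    subcomplex. In position 0 every row is a cycle. *)
Definition cycle_above (L : {set T}) i : 'rV[K]_(k i) -> Prop :=
  if i is j.+1 then fun u => forall c, L \subset W c -> (u *m C j) 0 c = 0
  else fun=> True.

(** Let Q(L, A) be the quotient complex on the labels between [L] and [A]. For [x] in [L], Q(L - x,
    A) has the subcomplex Q(L - x, A - x) with quotient Q(L, A). The long exact sequence reduces H_i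
    of Q(L, A) to H_i of Q(L - x, A) and H_(i-1) of Q(L - x, A - x); in the latter, [S] loses
    [x]. *)
Lemma exact_above (L A : {set T}) i (u : 'rV[K]_(k i)) :
  (forall S : {set T}, S \subset L -> #|S| = i -> nonface (A :\: S)) ->
  row_within (@W i) A u -> cycle_above L u ->
  exists2 t, row_within (@W i.+1) A t &
    forall c, L \subset W c -> u 0 c = (t *m C i) 0 c.
Proof.
elim: #|L| {-2}L (erefl #|L|) A i u => [|m IH] {}L.
  move/cards0_eq=> -> A [|i] u hS hu /= uC.
    have nA : nonface A by rewrite -(setD0 A); apply: hS; rewrite ?cards0 ?sub0set.
    by have [t ht ->] := C0_surj nA hu; exists t.
  have [_ _ /(_ A u hu)[|t ht ->]] := C_syz i; last by exists t.
  by apply/rowP=> c; rewrite uC ?sub0set // mxE.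
move=> cL A i u hS hu uC.
have /card_gt0P[x xL] : (0 < #|L|)%N by rewrite cL.
have cL' : #|L :\ x| = m by move: cL; rewrite (cardsD1 x) xL => -[].
have L'L : L :\ x \subset L by apply: subD1set.
case: i u hS hu uC => [|i] u hS hu uC.
  have [S hSL|//|//|t ht e] := IH _ cL' A 0 u.
    by apply: hS; apply: subset_trans hSL L'L.
  by exists t => // c hc; apply: e; apply: subset_trans hc.
(* The connecting homomorphism: [y] is the boundary of [u] on the labels containing [L :\ x]. Those
   that occur avoid [x], because [u] is a cycle above [L]. *)
have [y yE] : exists y : 'rV_(k i),
    forall c, y 0 c = if L :\ x \subset W c then (u *m C i) 0 c else 0.
  by exists (\row_c (if L :\ x \subset W c then (u *m C i) 0 c else 0)) => c; rewrite mxE.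
have yW : row_within (@W i) (A :\ x) y.
  move=> c; rewrite yE; case: ifP => [hc uc|_]; last by rewrite eqxx.
  have := row_within_mul (@C_down i) hu uc; rewrite subsetD1 => ->/=.
  apply: contra uc => xc; apply/eqP/uC.
  by rewrite -(setD1K xL) subUset sub1set xc.
have yC : cycle_above (L :\ x) y.
  case: i u {hS hu uC} y yE {yW} => // j u y yE c hc.
  have [_ CC _] := C_syz j.
  have -> : (y *m C j) 0 c = (u *m C j.+1 *m C j) 0 c.
    rewrite !mxE; apply: eq_bigr => r _; rewrite yE.
    case: ifP => // hr; have [->|/C_down hcr] := eqVneq (C j r c) 0.
      by rewrite !mulr0.
    by rewrite (subset_trans hc hcr) in hr.
  by rewrite -mulmxA CC mulmx0 mxE.
have [S hSL cS|z zW yz] := IH _ cL' _ i y _ yW yC.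
  have xS : x \notin S by apply/negP=> /(subsetP hSL); rewrite !inE eqxx.
  rewrite setDDl; apply: hS; last by rewrite cardsU1 xS cS.
  by rewrite subUset sub1set xL (subset_trans hSL L'L).
have zWA : row_within (@W i.+1) A z.
  by move=> r /zW /subset_trans; apply; apply: subD1set.
have uzC : cycle_above (L :\ x) (u - z).
  move=> c hc; rewrite mulmxBl mxE [X in _ + X]mxE -yz // yE hc.
  exact: subrr.
have [S hSL cS|t tW uzt] := IH _ cL' A i.+1 _ _ (row_withinB hu zWA) uzC.
  by apply: hS => //; apply: subset_trans hSL L'L.
(* The correction [z] lives on labels avoiding [x], so it vanishes on every label containing [L]. *)
exists t => // c hc; rewrite -uzt ?(subset_trans L'L) //.
rewrite mxE [X in _ + X]mxE; suff -> : z 0 c = 0 by rewrite subr0.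
apply/eqP/negPn/negP => /zW /subsetP /(_ x (subsetP hc _ xL)).
by rewrite !inE eqxx.
Qed.

(* The complex of basis elements of degree exactly [W r] has zero differential
   by minimality, so exactness there would kill [r]. *)
Lemma minimal_generator_face i (r : 'I_(k i)) :
  exists S : {set T}, [/\ S \subset W r, #|S| = i & ~ nonface (W r :\: S)].
Proof.
apply: contrapT => noS.
have hS (S : {set T}) : S \subset W r -> #|S| = i -> nonface (W r :\: S).
  by move=> ? ?; apply: contrapT => ?; apply: noS; exists S.
have dW : row_within (@W i) (W r) (delta_mx 0 r).
  by move=> c; rewrite mxE eqxx /=; case: (c =P r) => [->|]; rewrite ?eqxx.
have dC : cycle_above (W r) (delta_mx 0 r : 'rV_(k i)).
  case: i r {hS noS} dW => // i r _ c hc; rewrite -rowE mxE.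
  apply/eqP/negPn/negP => h; move/eqP: (h); apply; apply: C_min.
  by apply/eqP; rewrite eqEsubset hc (C_down h).
have [t tW /(_ r (subxx _))] := exact_above hS dW dC.
rewrite !mxE !eqxx big1 => [/eqP|s _]; first by rewrite oner_eq0.
have [->|/tW hs] := eqVneq (t 0 s) 0; first by rewrite mul0r.
have [->|h] := eqVneq (C i s r) 0; first by rewrite mulr0.
rewrite [C i s r]C_min ?mulr0 //.
by apply/eqP; rewrite eqEsubset hs (C_down h).
Qed.

End Bound.
End SquarefreeLinearAlgebra.

(** * From scalar matrices to polynomial matrices *)

Section SquarefreeMatrices.
Variables (K : fieldType) (n : nat).
Local Notation R := {mpoly K[n]}.
Implicit Types (A B : {set 'I_n}) (a b m : 'X_{1..n}).

Lemma mcoeffMX_if (p : R) m b :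
  (p * 'X_[m])@_b = if (m <= b)%MM then p@_(b - m) else 0.
Proof.
case: ifPn => [hm|]; first by rewrite -{1}(submK hm) addmC mcoeffMX.
apply: contraNeq; rewrite -mcoeff_msupp (perm_mem (msuppMX _ _)).
by case/mapP=> m' _ ->; apply: lem_addr.
Qed.

Definition mset A : 'X_{1..n} := [multinom (i \in A : nat) | i < n].
Definition msupport m : {set 'I_n} := [set i | m i != 0%N].

Lemma mdeg_mset A : mdeg (mset A) = #|A|.
Proof.
rewrite mdegE -sum1_card [RHS]big_mkcond; apply: eq_bigr => i _.
by rewrite mnmE; case: (i \in A).
Qed.

Lemma mset_le A m : (mset A <= m)%MM = (A \subset msupport m).
Proof.
apply/mnm_lepP/subsetP => [h i iA|h i].
  by have := h i; rewrite mnmE iA inE -lt0n.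
by rewrite mnmE; case: (boolP (i \in A)) => // /h; rewrite inE -lt0n.
Qed.

Lemma msupport_mset A : msupport (mset A) = A.
Proof. by apply/setP=> i; rewrite !inE mnmE eqb0 negbK. Qed.

Lemma mset_le_mset A B : (mset A <= mset B)%MM = (A \subset B).
Proof. by rewrite mset_le msupport_mset. Qed.

Lemma prodX_mset A : \prod_(i in A) 'X_i = 'X_[mset A] :> R.
Proof.
rewrite (mprodXE K (fun i => U_(i)%MM)); congr mpolyX.
apply/mnmP=> i; rewrite mnm_sumE mnmE.
have [iA|iA] := boolP (i \in A).
  rewrite (bigD1 i) //= mnm1E eqxx big1 // => j /andP[_ /negPf ji].
  by rewrite mnm1E ji.
by rewrite big1 // => j jA; rewrite mnm1E; case: eqP iA => // <-; rewrite jA.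
Qed.

(** The multidegrees of the basis elements fix the monomial of each entry. Subtraction of exponents
    is truncated, but for a [downward] matrix it is exact wherever the scalar is nonzero. *)
Definition lift_mx k k' (W : 'I_k -> {set 'I_n}) (W' : 'I_k' -> {set 'I_n})
  (C : 'M[K]_(k', k)) : 'M[R]_(k', k) :=
  \matrix_(r, c) (C r c *: 'X_[mset (W' r) - mset (W c)]).

(** The part of [v] in multidegree [a], basis vector [c] having multidegree [mset (W c)], recorded
    by its scalars alone; [inclusion] is the way back. *)
Definition component k (W : 'I_k -> {set 'I_n}) a (v : 'rV[R]_k) : 'rV[K]_k :=
  \row_c (if (mset (W c) <= a)%MM then (v 0 c)@_(a - mset (W c)) else 0).

Definition inclusion k (W : 'I_k -> {set 'I_n}) a (u : 'rV[K]_k) : 'rV[R]_k :=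
  \row_c (u 0 c *: 'X_[a - mset (W c)]).

Lemma component_within k (W : 'I_k -> {set 'I_n}) a v :
  row_within W (msupport a) (component W a v).
Proof. by move=> c; rewrite mxE -mset_le; case: ifP; rewrite ?eqxx. Qed.

Lemma component0 k (W : 'I_k -> {set 'I_n}) a : component W a 0 = 0.
Proof. by apply/rowP=> c; rewrite !mxE mcoeff0 if_same. Qed.

Lemma component_inj k (W : 'I_k -> {set 'I_n}) v v' :
  (forall a, component W a v = component W a v') -> v = v'.
Proof.
move=> h; apply/rowP=> c; apply/mpolyP=> m.
have /rowP/(_ c) := h (m + mset (W c))%MM.
by rewrite !mxE lem_addl addmK.
Qed.

Lemma component_mul k k' (W : 'I_k -> {set 'I_n}) (W' : 'I_k' -> {set 'I_n})
    (C : 'M[K]_(k', k)) a v :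
  downward W W' C ->
  component W a (v *m lift_mx W W' C) = component W' a v *m C.
Proof.
move=> hC; apply/rowP=> c; rewrite !mxE.
have [ca|ca] := ifPn; last first.
  rewrite big1 // => r _; rewrite mxE; case: ifP => ra; last by rewrite mul0r.
  have [->|/hC] := eqVneq (C r c) 0; first by rewrite mulr0.
  by rewrite -mset_le_mset => /lepm_trans/(_ ra); rewrite (negPf ca).
rewrite raddf_sum; apply: eq_bigr => r _ /=; rewrite !mxE -scalerAr mcoeffZ.
have [->|/hC] := eqVneq (C r c) 0; first by rewrite mul0r mulr0.
rewrite -mset_le_mset => cr; rewrite mulrC mcoeffMX_if; congr (_ * _).
have -> : (mset (W' r) - mset (W c) <= a - mset (W c))%MM = (mset (W' r) <= a)%MM.
  apply/mnm_lepP/mnm_lepP => h i; have := h i; rewrite !mnmBE.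
    by move: cr ca => /mnm_lepP/(_ i) ? /mnm_lepP/(_ i) ?; rewrite leq_subLR subnKC.
  by move=> ?; rewrite leq_sub2r.
case: ifP => // _; congr mcoeff; apply/mnmP=> i; rewrite !mnmBE.
by move/mnm_lepP: cr => /(_ i) ?; rewrite -subnDA subnKC.
Qed.

Lemma inclusion_mul k k' (W : 'I_k -> {set 'I_n}) (W' : 'I_k' -> {set 'I_n})
    (C : 'M[K]_(k', k)) a t :
  downward W W' C -> row_within W' (msupport a) t ->
  inclusion W' a t *m lift_mx W W' C = inclusion W a (t *m C).
Proof.
move=> hC ht; apply/rowP=> c; rewrite !mxE scaler_suml.
apply: eq_bigr => r _; rewrite !mxE.
have [->|/ht] := eqVneq (t 0 r) 0; first by rewrite scale0r !mul0r scale0r.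
have [->|/hC] := eqVneq (C r c) 0; first by rewrite scale0r !mulr0 scale0r.
rewrite -mset_le_mset -mset_le => cr ra.
rewrite -scalerAl -scalerAr scalerA -mpolyXD; congr (_ *: 'X_[_]).
apply/mnmP=> i; rewrite !(mnmDE, mnmBE).
by move/mnm_lepP: cr => /(_ i) ?; move/mnm_lepP: ra => /(_ i) ?; rewrite addnBA // subnK.
Qed.

Lemma inclusion_component k (W : 'I_k -> {set 'I_n}) v :
  exists N, v = \sum_(a : 'X_{1..n < N}) inclusion W a (component W a v).
Proof.
(* A monomial [m] of column [c] sits in multidegree [m + mset (W c)], whose second summand adds at
   most [n] to the degree. *)
exists (\max_c (msize (v 0%R c) + n).+1)%N; apply/rowP=> c; rewrite summxE.
apply/mpolyP=> m; rewrite raddf_sum /=.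
set N := (X in 'X_{1..n < X}).
pose b := (m + mset (W c))%MM.
have coefE a : (inclusion W a (component W a v) 0 c)@_m
    = if a == b then (v 0 c)@_m else 0.
  rewrite !mxE mcoeffZ mcoeffX; case: (a =P b) => [->|ab].
    by rewrite lem_addl addmK eqxx mulr1.
  case: ifP => ca; last by rewrite mul0r.
  case: eqP => [e|]; last by rewrite mulr0.
  by case: ab; rewrite /b -e submK.
under eq_bigr do rewrite coefE.
have [->|vm] := eqVneq ((v 0 c)@_m) 0; first by rewrite big1 // => a _; rewrite if_same.
have bN : (mdeg b < N)%N.
  rewrite /N (bigD1 c) //= leq_max ltnS mdegD mdeg_mset leq_add //.
    by apply/ltnW/msize_mdeg_lt; rewrite mcoeff_msupp.
  by rewrite -[leqRHS]card_ord max_card.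
rewrite (bigD1 (BMultinom bN)) //= eqxx big1 ?addr0 // => a.
by rewrite bmeqP /= => /negPf->.
Qed.

(** In multidegree [a] this is exactness of the strand at [msupport a]. Only finitely many
    components of [v] are nonzero, so their preimages can be summed. *)
Lemma lift_mx_exact k0 k1 k2 (W0 : 'I_k0 -> {set 'I_n}) (W1 : 'I_k1 -> {set 'I_n})
    (W2 : 'I_k2 -> {set 'I_n}) (C : 'M[K]_(k1, k0)) (C' : 'M[K]_(k2, k1)) (v : 'rV_k1) :
  downward W0 W1 C -> syzygies W1 W2 C' C ->
  v *m lift_mx W0 W1 C = 0 <-> exists w, v = w *m lift_mx W1 W2 C'.
Proof.
move=> hC [hC' CC ex]; split=> [vC|[w ->]]; last first.
  apply: (@component_inj _ W0) => a; rewrite component0.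
  by rewrite !component_mul // -mulmxA CC mulmx0.
have h a : exists t, row_within W2 (msupport a) t /\ component W1 a v = t *m C'.
  have [|t ht e] := ex _ _ (@component_within _ W1 a v); last by exists t.
  by rewrite -(component_mul (W := W0)) // vC component0.
have /choice[t ht] := h.
have [N vE] := inclusion_component W1 v.
exists (\sum_(a : 'X_{1..n < N}) inclusion W2 a (t a)).
rewrite {1}vE mulmx_suml; apply: eq_bigr => a _.
by have [? ->] := ht a; rewrite inclusion_mul.
Qed.

Lemma lift_mx_graded k0 k1 (W0 : 'I_k0 -> {set 'I_n}) (W1 : 'I_k1 -> {set 'I_n})
    (C : 'M[K]_(k1, k0)) r c : downward W0 W1 C ->
  ((#|W0 c| <= #|W1 r|)%N -> lift_mx W0 W1 C r c \is (#|W1 r| - #|W0 c|).-homog) /\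
  ((#|W1 r| < #|W0 c|)%N -> lift_mx W0 W1 C r c = 0).
Proof.
move=> hC; rewrite mxE; have [->|/hC cr] := eqVneq (C r c) 0.
  by rewrite scale0r; split=> // _; apply: dhomog0.
split=> [_|]; last by rewrite ltnNge subset_leq_card.
apply: dhomogZ; rewrite dhomogX -!mdeg_mset.
have /submK/(congr1 (@mdeg n)) : (mset (W0 c) <= mset (W1 r))%MM.
  by rewrite mset_le_mset.
by rewrite mdegD => <-; rewrite addnK.
Qed.

Lemma lift_mx_minimal k0 k1 (W0 : 'I_k0 -> {set 'I_n}) (W1 : 'I_k1 -> {set 'I_n})
    (C : 'M[K]_(k1, k0)) r c : downward W0 W1 C ->
  (W0 c = W1 r -> C r c = 0) -> (lift_mx W0 W1 C r c)@_0%MM = 0.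
Proof.
move=> hC h; rewrite mxE mcoeffZ mcoeffX.
have [->|C0] := eqVneq (C r c) 0; first by rewrite mul0r.
case: eqP => [e|]; last by rewrite mulr0.
rewrite h ?mul0r //; apply/eqP; rewrite eqEsubset hC // -mset_le_mset.
by apply/mnm_lepP=> i; rewrite -subn_eq0 -mnmBE e mnm0E.
Qed.

End SquarefreeMatrices.

(** * Comparison of minimal graded resolutions *)

Section Comparison.
Variables (K : fieldType) (n : nat).
Local Notation R := {mpoly K[n]}.

(* The component of degree [d] of [p] times a basis vector of degree [e]. *)
Definition shifted_part (d e : nat) (p : R) : R :=
  if (e <= d)%N then pihomog mdeg (d - e) p else 0.

Definition shifted_homog (d e : nat) (p : R) : Prop :=
  ((e <= d)%N -> p \is (d - e).-homog) /\ ((d < e)%N -> p = 0).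

Lemma shifted_part_homog d e p : shifted_homog d e (shifted_part d e p).
Proof.
rewrite /shifted_part; split=> [->|]; first exact: pihomogP.
by rewrite ltnNge => /negPf->.
Qed.

Lemma shifted_part_id d e p : shifted_homog d e p -> shifted_part d e p = p.
Proof.
rewrite /shifted_part => -[h1 h2]; have [/h1 h|/h2 ->//] := leqP e d.
exact: pihomog_dE.
Qed.

Lemma shifted_part_is_linear d e : linear (shifted_part d e).
Proof.
move=> a p q; rewrite /shifted_part; case: ifP => _; first exact: linearP.
by rewrite scaler0 addr0.
Qed.
HB.instance Definition _ d e := GRing.isLinear.Build K R R _ (shifted_part d e)
  (@shifted_part_is_linear d e).

Lemma shifted_part_mul d e e' p q : shifted_homog e e' q ->
  shifted_part d e' (p * q) = shifted_part d e p * q.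
Proof.
move=> [h1 h2]; have [le|/h2->] := leqP e' e; last by rewrite !mulr0 raddf0.
elim/mpolyind: p => [|c m p mp c0 IH]; first by rewrite mul0r !raddf0 mul0r.
rewrite mulrDl !raddfD /= mulrDl IH -scalerAl !linearZ /= -scalerAl; congr (_ *: _ + _).
have hq : 'X_[m] * q \is (mdeg m + (e - e')).-homog.
  by apply: dhomogM (h1 le); rewrite dhomogX.
rewrite /shifted_part; have [ed|de] := leqP e d.
  rewrite (leq_trans le ed) pihomogX; case: eqP => [md|md].
    by rewrite pihomog_dE //; move: hq; rewrite md addnBA // subnK.
  rewrite mul0r (pihomog_ne0 _ hq) //; apply/eqP=> E; apply: md.
  by apply/eqP; rewrite -(eqn_add2r (e - e')) E addnBA // subnK.
rewrite mul0r; case: ifP => // e'd; rewrite (pihomog_ne0 _ hq) //.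
rewrite gtn_eqF // (leq_trans _ (leq_addl _ _)) // ltn_sub2r //.
exact: leq_ltn_trans de.
Qed.

Lemma shifted_homog_const d e p : shifted_homog d e p -> p@_0%MM != 0 -> d = e.
Proof.
move=> [h1 h2]; have [le|/h2->] := leqP e d; last by rewrite mcoeff0 eqxx.
move=> p0; have /dhomogP/(_ 0%MM) := h1 le.
rewrite mcoeff_msupp p0 => /(_ isT) /=; rewrite mdeg0 => /esym/eqP; rewrite subn_eq0 => h.
by apply/eqP; rewrite eqn_leq h.
Qed.

Definition graded_mx k k' (dr : 'I_k' -> nat) (dc : 'I_k -> nat) (D : 'M[R]_(k', k)) :=
  forall r c, shifted_homog (dr r) (dc c) (D r c).

Definition row_part k (dc : 'I_k -> nat) d (v : 'rV[R]_k) : 'rV[R]_k :=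
  \row_c shifted_part d (dc c) (v 0 c).

Lemma row_part_mul k k' (dr : 'I_k' -> nat) (dc : 'I_k -> nat) D d v :
  graded_mx dr dc D -> row_part dc d (v *m D) = row_part dr d v *m D.
Proof.
move=> hD; apply/rowP=> c; rewrite !mxE raddf_sum; apply: eq_bigr => r _ /=.
by rewrite mxE; apply: shifted_part_mul.
Qed.

Lemma row_part_row k k' (dr : 'I_k' -> nat) (dc : 'I_k -> nat) D r :
  graded_mx dr dc D -> row_part dc (dr r) (row r D) = row r D.
Proof. by move=> hD; apply/rowP=> c; rewrite !mxE shifted_part_id. Qed.

Variables (M : lmodType R) (hom : nat -> M -> Prop).

(** Only multiples of homogeneous elements are prescribed; with additivity this determines [part] on
    the image of a graded augmentation. *)
Definition grading_projection (part : nat -> M -> M) :=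
  forall d, {morph part d : x y / x + y} /\
    forall e p x, hom e x -> part d (p *: x) = shifted_part d e p *: x.

Lemma aug_map_mul (F : free_complex M) k (v : 'rV_k) (D : 'M_(k, rk F 0)) :
  aug_map (v *m D) = \sum_r v 0 r *: @aug_map K n M F (row r D).
Proof.
rewrite /aug_map; under [RHS]eq_bigr do rewrite scaler_sumr.
rewrite exchange_big /=; apply: eq_bigr => c _; rewrite mxE scaler_suml.
by apply: eq_bigr => r _; rewrite scalerA mxE.
Qed.


Lemma aug_map_matrix (F G : free_complex M) (phi : 'M[R]_(rk F 0, rk G 0)) :
  (forall r, aug_map (row r phi) = @aug _ _ _ F r) ->
  forall v, aug_map (v *m phi) = aug_map v.
Proof.
by move=> h v; rewrite aug_map_mul; apply: eq_bigr => r _; rewrite h.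
Qed.

Variable part : nat -> M -> M.
Hypothesis part_grading : grading_projection part.

Lemma aug_map_part (F : free_complex M) d v : is_graded hom F ->
  part d (aug_map v) = aug_map (row_part (@dg _ _ _ F 0) d v).
Proof.
move=> [Fhom _]; have [partD partZ] := part_grading d.
have part0 : part d 0 = 0.
  by apply: (addrI (part d 0)); rewrite -partD !addr0.
rewrite /aug_map (big_morph _ partD part0); apply: eq_bigr => c _.
by rewrite mxE (partZ _ _ _ (Fhom c)).
Qed.

Lemma is_graded_df (F : free_complex M) i :
  is_graded hom F -> graded_mx (@dg _ _ _ F i.+1) (@dg _ _ _ F i) (df F i).
Proof. by move=> [_ h] r c; apply: h. Qed.

(* At [0] the map lifts the identity of [M]. *)
Definition chain_condition (F G : free_complex M) i :
    'M[R]_(rk F i, rk G i) -> Prop :=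
  match i with
  | 0 => fun phi => forall v : 'rV_(rk F 0), aug_map (v *m phi) = aug_map v
  | j.+1 => fun phi => forall v : 'rV_(rk F j.+1),
      v *m df F j = 0 -> v *m phi *m df G j = 0
  end.

(** Chain maps are chosen position by position: the type of a choice depends on its index, and each
    choice must commute with the preceding one. *)
Lemma dependent_choice_nat (X : nat -> Type) (P : forall i, X i -> Prop)
    (Q : forall i, X i -> X i.+1 -> Prop) :
  (exists x, P 0 x) -> (forall i x, P i x -> exists2 y, P i.+1 y & Q i x y) ->
  exists f : forall i, X i, forall i, P i (f i) /\ Q i (f i) (f i.+1).
Proof.
move=> /cid[x0 Px0] step.
pose next i (x : {x | P i x}) : {x | P i.+1 x} :=
  let y := cid2 (step i (sval x) (svalP x)) in exist _ (s2val y) (s2valP y).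
pose f := fix f i : {x | P i x} := if i is j.+1 then next j (f j) else exist _ x0 Px0.
exists (fun i => sval (f i)) => i; split; first exact: svalP.
exact: s2valP' (cid2 _).
Qed.

(** Comparison theorem: each row is lifted by exactness of [G]. A lift need not be homogeneous, but
    its part in the degree of the row is again a lift, because all the maps involved are graded. *)
Lemma exists_chain_map (F G : free_complex M) :
  is_graded hom F -> is_graded hom G -> is_resolution F -> is_resolution G ->
  exists phi : forall i, 'M[R]_(rk F i, rk G i),
    [/\ forall v, aug_map (v *m phi 0) = aug_map v,
        forall i, df F i *m phi i = phi i.+1 *m df G i
      & forall i, graded_mx (@dg _ _ _ F i) (@dg _ _ _ G i) (phi i)].
Proof.
move=> Fg Gg [_ F0 FS] [Gsurj G0 GS].
pose P i (phi : 'M[R]_(rk F i, rk G i)) :=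
  @chain_condition F G i phi /\ graded_mx (@dg _ _ _ F i) (@dg _ _ _ G i) phi.
pose Q i (phi : 'M[R]_(rk F i, rk G i)) phi' := df F i *m phi = phi' *m df G i.
have [||phi phiP] := @dependent_choice_nat _ P Q; last first.
- exists phi; split=> i; first by have [[? _] _] := phiP 0; auto.
    by have [] := phiP i.
  by have [[_ ?] _] := phiP i; auto.
- move=> i phi [phiC phig].
  have /choice[w wE] : forall r, exists w, row r (df F i) *m phi = w *m df G i.
    case: i phi phiC {phig} => [|i] phi /= phiC r.
      apply/G0; rewrite phiC; apply/F0; exists (delta_mx 0 r); exact: rowE.
    by apply/GS/phiC; apply/FS; exists (delta_mx 0 r); apply: rowE.
  pose phi' : 'M[R]_(rk F i.+1, rk G i.+1) :=
    \matrix_r row_part (@dg _ _ _ G i.+1) (dg r) (w r).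
  have phiE : Q i phi phi'.
    apply/row_matrixP=> r; rewrite !row_mul rowK.
    rewrite -(row_part_mul _ _ (is_graded_df Gg)) -wE.
    by rewrite (row_part_mul _ _ phig) (row_part_row _ (is_graded_df Fg)).
  exists phi' => //; split.
    by move=> v vF; rewrite -mulmxA -phiE mulmxA vF mul0mx.
  by move=> r c; rewrite !mxE; apply: shifted_part_homog.
have /choice[w wE] : forall r, exists w : 'rV_(rk G 0), aug_map w = @aug _ _ _ F r.
  by move=> r; apply: Gsurj.
exists (\matrix_r row_part (@dg _ _ _ G 0) (dg r) (w r)); split.
  apply: aug_map_matrix => r; rewrite rowK -aug_map_part // wE.
  have [_ partZ] := part_grading (dg r).
  (* [part] is specified on multiples of homogeneous elements, so the generator is read as 1 times
     itself. *)
  rewrite -[X in part _ X]scale1r (partZ _ _ _ (Fg.1 r)) shifted_part_id ?scale1r //.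
  by split; rewrite ?subnn ?ltnn // => _; apply: dhomog1.
by move=> r c; rewrite !mxE; apply: shifted_part_homog.
Qed.

(** A chain endomorphism inducing zero on [M] is null-homotopic. It will be applied to the
    difference between a round trip and the identity. *)
Lemma homotopy_identity (F : free_complex M) (e : forall i, 'M[R]_(rk F i)) :
  is_resolution F ->
  (forall v, aug_map (v *m e 0) = 0) ->
  (forall i, df F i *m e i = e i.+1 *m df F i) ->
  forall i, exists h h', e i.+1 = h *m df F i.+1 + df F i *m h'.
Proof.
move=> [_ F0 FS] e0 eS.
have liftrow i (D : 'M_(rk F i.+1)) : D *m df F i = 0 -> exists h, D = h *m df F i.+1.
  move=> D0; have /choice[h hE] : forall r, exists w, row r D = w *m df F i.+1.
    by move=> r; apply/FS; rewrite -row_mul D0 row0.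
  by exists (\matrix_r h r); apply/row_matrixP=> r; rewrite row_mul rowK.
have dfdf i : df F i.+1 *m df F i = 0.
  by apply/row_matrixP=> r; rewrite row_mul row0; apply/FS; exists (delta_mx 0 r); rewrite -rowE.
have e0E : exists h, e 0 = h *m df F 0.
  have /choice[h hE] : forall r, exists w, row r (e 0) = w *m df F 0.
    by move=> r; apply/F0; rewrite rowE e0.
  by exists (\matrix_r h r); apply/row_matrixP=> r; rewrite row_mul rowK.
elim=> [|i [h [h' E]]].
  have [h hE] := e0E.
  have /liftrow[h2 E2] : (e 1 - df F 0 *m h) *m df F 0 = 0.
    by rewrite mulmxBl -eS hE mulmxA subrr.
  by exists h2, h; rewrite -E2 subrK.
have /liftrow[h2 E2] : (e i.+2 - df F i.+1 *m h) *m df F i.+1 = 0.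
  by rewrite mulmxBl -eS E mulmxDr mulmxA mulmxA dfdf mul0mx addr0 subrr.
by exists h2, h; rewrite -E2 subrK.
Qed.

(** The round trip [F] to [G] to [F] minus the identity is null-homotopic, so by minimality of [F]
    its entries on the diagonal have no constant term. Hence some entry of [phi] in row [r] has a
    nonzero constant term, and such an entry joins generators of equal degree. *)
Lemma minimal_generator_degree (F G : free_complex M) i (r : 'I_(rk F i)) :
  min_graded_resolution hom F -> is_graded hom G -> is_resolution G ->
  exists c : 'I_(rk G i), dg c = dg r.
Proof.
move=> [Fg Fr Fmin] Gg Gr.
have [phi [phi0 phiS phig]] := exists_chain_map Fg Gg Fr Gr.
have [psi [psi0 psiS psig]] := exists_chain_map Gg Fg Gr Fr.
pose e i := phi i *m psi i - 1%:M.
have eS j : df F j *m e j = e j.+1 *m df F j.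
  by rewrite mulmxBl mulmxBr mulmxA phiS -mulmxA psiS mulmxA mulmx1 mul1mx.
have aug_mapB (v w : 'rV_(rk F 0)) : aug_map (v - w) = aug_map v - aug_map w.
  rewrite /aug_map -sumrB; apply: eq_bigr => c _; by rewrite !mxE scalerBl.
have e0 v : aug_map (v *m e 0) = 0.
  by rewrite mulmxBr aug_mapB mulmxA psi0 phi0 mulmx1 subrr.
have const_mul k k' k'' (A : 'M[R]_(k, k')) (B : 'M[R]_(k', k'')) p c :
    ((A *m B) p c)@_0%MM = \sum_q (A p q)@_0%MM * (B q c)@_0%MM.
  by rewrite mxE raddf_sum; apply: eq_bigr => q _; rewrite /= rmorphM.
have eE : (e i r r)@_0%MM = 0.
  have dF_const j k (A : 'M[R]_(k, rk F j.+1)) p c : ((A *m df F j) p c)@_0%MM = 0.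
    by rewrite const_mul big1 // => q _; rewrite Fmin mulr0.
  case: i r => [|i] r.
    have [_ F0 _] := Fr; have [|w] := (F0 (row r (e 0))).1; first by rewrite rowE e0.
    by move/rowP/(_ r); rewrite mxE => ->.
  have [h [h' ->]] := homotopy_identity Fr e0 eS i.
  rewrite mxE raddfD /= dF_const add0r const_mul big1 // => q _.
  by rewrite Fmin mul0r.
have : ((phi i *m psi i) r r)@_0%MM = 1.
  move/eqP: eE; rewrite !mxE eqxx raddfB /= subr_eq0 => /eqP->.
  by rewrite mcoeff1 eqxx.
rewrite const_mul => sum1; have [c c0|noc] := pickP (fun c => (phi i r c)@_0%MM != 0).
  by exists c; apply/esym/(shifted_homog_const _ c0)/phig.
move: sum1; rewrite big1 => [/esym/eqP|c _]; first by rewrite oner_eq0.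
by move/negbFE/eqP: (noc c) => ->; rewrite mul0r.
Qed.

End Comparison.

(** * Krull dimension *)

Section KrullDimension.
Variables (K : fieldType) (n : nat).
Local Notation R := {mpoly K[n]}.

Local Notation evaluation := (mmap (@mpolyC n K)).

Lemma msize_evaluationX m (f : 'I_m -> R) (a : 'X_{1..m}) N D :
  (forall i, (a i < N)%N) -> (forall i, (msize (f i) <= D.+1)%N) ->
  (msize (evaluation f 'X_[a]) <= (m * (N * D)).+1)%N.
Proof.
move=> aN fD; have mulD (p q : R) x y : (msize p <= x.+1)%N -> (msize q <= y.+1)%N ->
    (msize (p * q) <= (x + y).+1)%N.
  move=> px qy; have [->|p0] := eqVneq p 0; first by rewrite mul0r msize0.
  have [->|q0] := eqVneq q 0; first by rewrite mulr0 msize0.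
  by rewrite msizeM //; move: (msize p) (msize q) px qy => u v; lia.
rewrite mmapX /mmap1.
have -> : (m * (N * D) = \sum_(i < m) N * D)%N by rewrite sum_nat_const card_ord.
elim/big_ind2: _ => [|x1 x2 y1 y2|i _]; first by rewrite msize1.
  exact: mulD.
have expD e : (msize (f i ^+ e) <= (e * D).+1)%N.
  elim: e => [|e IH]; first by rewrite expr0 msize1.
  by rewrite exprS mulSn mulD.
by rewrite (leq_trans (expD _)) // ltnS leq_mul2r (ltnW (aN i)) orbT.
Qed.

(** A dimension count: there are more monomials in the [f i] with exponents below [N] than monomials
    to expand them in, so the coefficient matrix has a nonzero left kernel. *)
Lemma algebraic_dependence (f : 'I_n.+1 -> R) :
  exists2 Q : {mpoly K[n.+1]}, Q != 0 & evaluation f Q = 0.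
Proof.
pose D := (\max_i msize (f i))%N.
have fD i : (msize (f i) <= D.+1)%N.
  by apply: leqW; apply: (leq_bigmax (F := fun i => msize (f i))).
(* The values have degree below [L], hence involve at most [L ^ n] monomials. As [L] is at most
   [(n.+1 * D).+1 * N], this choice of [N] makes [L ^ n] smaller than [N ^ n.+1]. *)
pose N := ((n.+1 * D).+1 ^ n).+1.
pose L := (n.+1 * (N * D)).+1.
pose A := {ffun 'I_n.+1 -> 'I_N}; pose B := {ffun 'I_n -> 'I_L}.
have cardAB : (#|{: B}| < #|{: A}|)%N.
  rewrite !card_ffun !card_ord expnS.
  apply: (@leq_ltn_trans ((n.+1 * D).+1 ^ n * N ^ n)%N).
    have LN : (L <= (n.+1 * D).+1 * N)%N.
      by rewrite [leqRHS]mulSn -[leqLHS]add1n leq_add // mulnCA mulnC.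
    have LNe e : (L ^ e <= ((n.+1 * D).+1 * N) ^ e)%N.
      by elim: e => // e IH; rewrite !expnS leq_mul.
    by rewrite -expnMn.
  by rewrite ltn_pmul2r // expn_gt0.
pose mA (a : A) : 'X_{1..n.+1} := [multinom (a i : nat) | i < n.+1].
pose mB (b : B) : 'X_{1..n} := [multinom (b i : nat) | i < n].
have mA_inj : injective mA.
  move=> a a' /mnmP e; apply/ffunP=> i; apply: val_inj.
  by have := e i; rewrite !mnmE.
pose X : 'M[K]_(#|{: A}|, #|{: B}|) :=
  \matrix_(r, c) (evaluation f 'X_[mA (enum_val r)])@_(mB (enum_val c)).
have : kermx X != 0.
  rewrite kermx_eq0; apply/negP => /eqP rX.
  by have := rank_leq_col X; rewrite rX leqNgt cardAB.
case/rowV0Pn=> u /sub_kermxP uX u0.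
pose Q : {mpoly K[n.+1]} := \sum_r u 0 r *: 'X_[mA (enum_val r)].
have QE r : Q@_(mA (enum_val r)) = u 0 r.
  rewrite raddf_sum (bigD1 r) //= mcoeffZ mcoeffX eqxx mulr1 big1 ?addr0 // => s sr.
  by rewrite mcoeffZ mcoeffX (inj_eq mA_inj) (inj_eq enum_val_inj) (negPf sr) mulr0.
exists Q.
  apply: contraNneq u0 => Q0; apply/eqP/rowP=> r.
  by rewrite -QE Q0 mcoeff0 mxE.
apply/mpolyP=> m; rewrite mcoeff0 /Q rmorph_sum raddf_sum /=.
have [mL|mL] := leqP L (mdeg m).
  rewrite big1 // => r _; rewrite mmapZ mcoeffCM memN_msupp_eq0 ?mulr0 //.
  apply: msize_mdeg_ge; apply: leq_trans mL.
  by apply: msize_evaluationX => // i; rewrite mnmE.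
have mi i : (m i < L)%N.
  by apply: leq_ltn_trans mL; rewrite mdegE (bigD1 i) //= leq_addr.
pose b : B := [ffun i => Ordinal (mi i)].
have -> : m = mB (enum_val (enum_rank b)).
  by apply/mnmP=> i; rewrite enum_rankK mnmE ffunE.
transitivity ((u *m X) 0 (enum_rank b)); last by rewrite uX mxE.
rewrite mxE; apply: eq_bigr => r _.
by rewrite mmapZ mcoeffCM mxE.
Qed.

(** The supports are recorded so that variables absent from [Q] stay absent from both parts, while
    [Q0] also loses the variable [k]. *)
Lemma split_variable m (k : 'I_m) (Q : {mpoly K[m]}) : exists Q0 Q1,
  [/\ Q = Q0 + 'X_k * Q1,
      forall a, a \in msupp Q0 -> a \in msupp Q /\ a k = 0%N &
      forall a, a \in msupp Q1 -> (a + U_(k))%MM \in msupp Q].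
Proof.
pose Q0 : {mpoly K[m]} := \sum_(a <- msupp Q | a k == 0%N) Q@_a *: 'X_[a].
pose Q1 : {mpoly K[m]} := \sum_(a <- msupp Q | a k != 0%N) Q@_a *: 'X_[a - U_(k)].
exists Q0, Q1; split.
- rewrite {1}[Q]mpolyE (bigID (fun a : 'X_{1..m} => a k == 0%N)) /=; congr (_ + _).
  rewrite mulr_sumr; apply: eq_bigr => a ak.
  by rewrite -scalerAr -mpolyXD addmC submK // lep1mP.
- move=> a /msupp_sum_le/flattenP[s /mapP[b]].
  rewrite mem_filter => /andP[/eqP bk bQ] -> /msuppZ_le.
  by rewrite msuppX inE => /eqP->.
move=> a /msupp_sum_le/flattenP[s /mapP[b]].
rewrite mem_filter => /andP[bk bQ] -> /msuppZ_le.
by rewrite msuppX inE => /eqP->; rewrite submK // lep1mP.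
Qed.

(* Coquand and Lombardi: [x k] lies in [P k.+1] but not in [P k], so a relation
   [Q0 + x k * Q1] in [P k] forces [Q0] into [P k.+1] or, if [Q0 = 0], [Q1] into
   [P k]. *)
Lemma chain_algebraically_independent m (P : nat -> {pred R}) (x : 'I_m -> R) :
  (forall k, (k <= m)%N -> idealr_closed (P k) /\ prime_idealr_closed (P k)) ->
  (forall k : 'I_m, {subset P k <= P k.+1}) ->
  (forall k : 'I_m, x k \in P k.+1 /\ x k \notin P k) ->
  forall k, (k <= m)%N -> forall Q : {mpoly K[m]}, Q != 0 ->
    (forall a, a \in msupp Q -> forall i : 'I_m, (i < k)%N -> a i = 0%N) ->
    evaluation x Q \notin P k.
Proof.
(* The outer induction is on [m - k], the inner one on [msize Q]. At [k = m] the polynomial is a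
   nonzero constant, and a proper ideal contains no unit. *)
move=> Pprime Psub xP k km; move: {2}(m - k)%N (erefl (m - k)%N) => j.
elim: j k km => [|j IHj] k km mk.
  move=> Q Q0 Qk; have kE : k = m by apply/eqP; rewrite eqn_leq km -subn_eq0 mk.
  have QC : Q = (Q@_0%MM)%:MP.
    apply/mpolyP=> a; rewrite mcoeffC; have [->|a0] := eqVneq a 0%MM.
      by rewrite mulr1.
    rewrite mulr0; apply: memN_msupp_eq0; apply: contraNN a0 => aQ.
    by apply/eqP/mnmP=> i; rewrite mnm0E (Qk _ aQ) // kE.
  have c0 : Q@_0%MM != 0 by apply: contraNneq Q0 => c0; rewrite QC c0 mpolyC0.
  have [[P0 P1 Pid] _] := Pprime k km.
  rewrite QC mmapC; apply: contra P1 => cP.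
  have := Pid ((Q@_0%MM)^-1)%:MP _ _ cP P0.
  by rewrite addr0 -mpolyCM mulVf // mpolyC1.
have ltkm : (k < m)%N by rewrite -subn_gt0 mk.
pose i := Ordinal ltkm; have [[P0 P1 Pid] Pp] := Pprime k km.
have [[P0' P1' Pid'] _] := Pprime k.+1 ltkm.
move=> Q; move: {2}(msize Q) (leqnn (msize Q)) => s.
elim: s Q => [|s IHs] Q Qs Qn0 Qk.
  by move: Qs; rewrite leqn0 msize_poly_eq0 (negPf Qn0).
have [Q0 [Q1 [QE supp0 supp1]]] := split_variable i Q.
have evE : evaluation x Q = evaluation x Q0 + x i * evaluation x Q1.
  by rewrite {1}QE rmorphD rmorphM /= mmapX mmap1U.
have [Q0z|Q0n0] := eqVneq Q0 0.
  rewrite evE Q0z raddf0 add0r.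
  apply/negP=> /Pp; rewrite (negPf (xP i).2) /=; apply/negP.
  have Q1n0 : Q1 != 0.
    by apply: contraNneq Qn0 => Q10; rewrite QE Q0z Q10 mulr0 addr0.
  apply: IHs => // [|a aQ1 l lk].
    have XQ : msize Q = (msize Q1).+1.
      rewrite QE Q0z add0r msizeM // ?msizeX ?mdeg1 //.
      by rewrite -msize_poly_eq0 msizeX.
    by move: Qs; rewrite XQ.
  have := Qk _ (supp1 _ aQ1) l lk; rewrite mnmDE => /eqP.
  by rewrite addn_eq0 => /andP[/eqP].
apply/negP=> QP; suff : evaluation x Q0 \in P k.+1.
  apply/negP; apply: IHj => //; first by rewrite subnS mk.
  move=> a /supp0[aQ ak] l; rewrite ltnS leq_eqVlt => /orP[/eqP lk|].
    by rewrite -[RHS]ak; congr (a _); apply: val_inj.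
  exact: Qk.
have := Pid' (- evaluation x Q1) _ _ (xP i).1 (Psub i _ QP).
by rewrite evE mulNr mulrC addrCA addNr addr0.
Qed.


(** A longer chain, pulled back to the polynomial ring, would give [n.+1] elements satisfying no
    algebraic relation, against [algebraic_dependence]. *)
Lemma prime_chain_length (I : idealr R) d (P : 'I_d.+1 -> {pred {ideal_quot I}}) :
  prime_chain P -> (d <= n)%N.
Proof.
move=> [Pp Plt]; rewrite leqNgt; apply/negP => nd.
pose P' (k : nat) : {pred R} := fun p => \pi_({ideal_quot I}) p \in P (inord k).
have inP' k p : (p \in P' k) = (\pi_({ideal_quot I}) p \in P (inord k)) by [].
have lt_inord k : (k < n.+1)%N -> ((inord k : 'I_d.+1) < (inord k.+1 : 'I_d.+1))%N.
  by move=> kn; rewrite !inordK //; lia.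
have P'p k : (k <= n.+1)%N -> idealr_closed (P' k) /\ prime_idealr_closed (P' k).
  move=> _; have [[P0 P1 Pid] Ppr] := Pp (inord k); split; first split.
  - by rewrite inP' rmorph0.
  - by rewrite inP' rmorph1.
  - by move=> a u v; rewrite !inP' rmorphD rmorphM; apply: Pid.
  by move=> u v; rewrite !inP' rmorphM; apply: Ppr.
have P'S (k : 'I_n.+1) : {subset P' k <= P' k.+1}.
  by move=> p; rewrite !inP'; apply: (Plt _ _ (lt_inord k (ltn_ord k))).1.
have /choice[x xP] : forall k : 'I_n.+1, exists x, x \in P' k.+1 /\ x \notin P' k.
  move=> k; have [_ [y y1 y2]] := Plt _ _ (lt_inord k (ltn_ord k)).
  by exists (repr y); rewrite !inP' reprK.
have [Q Q0 Qx] := algebraic_dependence x.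
have := chain_algebraically_independent P'p P'S xP (leq0n _) Q0.
rewrite Qx inP' rmorph0 => /(_ (fun _ _ _ => ltac:(by [])))/negP; apply.
by have [[] ] := Pp (inord 0).
Qed.

(** The kernel is the prime ideal generated by the variables outside [F]. *)
Definition restriction (F : {set 'I_n}) : R -> R :=
  mmap (@mpolyC n K) (fun i => if i \in F then 'X_i else 0).
HB.instance Definition _ F := GRing.RMorphism.copy (restriction F)
  (mmap (@mpolyC n K) (fun i => if i \in F then 'X_i else 0)).

Lemma restrictionX F i : restriction F 'X_i = if i \in F then 'X_i else 0.
Proof. by rewrite /restriction mmapX mmap1U. Qed.

Lemma restrictionC F c : restriction F c%:MP = c%:MP.
Proof. exact: mmapC. Qed.

Lemma restriction_sub (F F' : {set 'I_n}) p : F' \subset F ->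
  restriction F' (restriction F p) = restriction F' p.
Proof.
move=> FF'; elim/mpolyind: p => [|c m p _ _ IH]; first by rewrite !raddf0.
rewrite !rmorphD /= IH -mul_mpolyC !rmorphM /= !restrictionC mpolyXE_id.
congr (_ * _ + _); rewrite !rmorph_prod; apply: eq_bigr => i _ /=.
rewrite !rmorphXn /= !restrictionX; case: ifP => [_|iF]; first by rewrite restrictionX.
by rewrite raddf0; case: ifP => // /(subsetP FF'); rewrite iF.
Qed.

End KrullDimension.

(** * Prime chains from faces *)

Section FaceChain.
Variables (K : fieldType) (n : nat) (D : simplicial_complex n).
Local Notation R := {mpoly K[n]}.

Lemma restriction_SR F p : F \in faces D -> p \in SR_ideal K D -> restriction F p = 0.
Proof.
move=> FD /asboolP[s [sN ->]]; rewrite rmorph_sum big_seq big1 //= => g /sN[N NN ->].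
rewrite rmorphM rmorph_prod /=.
have /subsetPn[i iN iF] : ~~ (N \subset F).
  have [Nn _] := minsetP NN; apply: contra Nn => NF; exact: facesS NF FD.
by rewrite (bigD1 i) //= restrictionX (negPf iF) mul0r mulr0.
Qed.

Definition face_prime F : {pred SR_ring K D} := fun x => restriction F (repr x) == 0.

Lemma face_primeE F p : F \in faces D ->
  (\pi_(SR_ring K D) p \in face_prime F) = (restriction F p == 0).
Proof.
move=> FD; rewrite /face_prime unfold_in.
have : repr (\pi_(SR_ring K D) p) - p \in SR_ideal K D.
  by rewrite Quotient.idealrBE reprK.
by move/(restriction_SR FD); rewrite raddfB => /eqP; rewrite subr_eq0 => /eqP->.
Qed.

(** Removing the vertices of [F] one at a time gives decreasing faces and increasing kernels of
    restrictions. These are prime because polynomials form a domain, and a removed variable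
    witnesses each strict inclusion. *)
Lemma face_chain F : F \in faces D ->
  exists P : 'I_#|F|.+1 -> {pred SR_ring K D}, prime_chain P.
Proof.
move=> FD.
pose G k := [set i in take (#|F| - k) (enum F)].
have GS k l : (k <= l)%N -> G l \subset G k.
  move=> kl; apply/subsetP=> i; rewrite !inE; apply: mem_subseq.
  have -> : take (#|F| - l) (enum F) = take (#|F| - l) (take (#|F| - k) (enum F)).
    by rewrite take_takel // leq_sub2l.
  exact: take_subseq.
have GD k : G k \in faces D.
  apply: facesS FD; apply/subsetP=> i; rewrite inE => /mem_take.
  by rewrite mem_enum.
have Gcard k : #|G k| = (#|F| - k)%N.
  rewrite cardsE (card_uniqP _) ?take_uniq ?enum_uniq // size_take -cardE.
  by case: ltnP => // h; apply/eqP; rewrite eqn_leq h leq_subr.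
have piE x : exists p, x = \pi_(SR_ring K D) p by exists (repr x); rewrite reprK.
exists (fun k => face_prime (G k)); split=> [k|k l kl].
  split; first split.
  - by rewrite -(rmorph0 (\pi_(SR_ring K D))) face_primeE // raddf0.
  - by rewrite -(rmorph1 (\pi_(SR_ring K D))) face_primeE // rmorph1 oner_eq0.
  - move=> a u v; have [a' ->] := piE a; have [u' ->] := piE u; have [v' ->] := piE v.
    rewrite !face_primeE // => /eqP u0 /eqP v0; rewrite -rmorphM -rmorphD face_primeE //.
    by rewrite rmorphD rmorphM /= u0 v0 mulr0 addr0.
  move=> u v; have [u' ->] := piE u; have [v' ->] := piE v.
  by rewrite -rmorphM !face_primeE // rmorphM mulf_eq0.
split=> [x|].
  have [p ->] := piE x; rewrite !face_primeE // => /eqP p0.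
  by rewrite -(restriction_sub p (GS _ _ (ltnW kl))) p0 raddf0.
have /properP[_ [i ik il]] : G l \proper G k.
  rewrite properEcard GS ?(ltnW kl) // !Gcard ltn_sub2l //.
  by rewrite (leq_trans kl) // -ltnS.
exists (\pi_(SR_ring K D) 'X_i); rewrite face_primeE // restrictionX.
  by rewrite (negPf il).
by rewrite ik -msize_poly_eq0 msizeX.
Qed.

End FaceChain.

(** * Maxima of sets of integers *)

Lemma max_int_eq (S : int -> Prop) m : S m -> (forall k, S k -> k <= m) -> max_int S = m.
Proof.
move=> Sm mmax; rewrite /max_int; case: pselect => [ex|]; last by case; exists m.
case: cid => m' /= [Sm' m'max].
by apply/eqP; rewrite eq_le mmax // m'max.
Qed.

Lemma max_int0 (S : int -> Prop) : (forall k, ~ S k) -> max_int S = 0.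
Proof.
move=> S0; rewrite /max_int; case: pselect => // ex.
by case: cid => m /= [/S0].
Qed.

Lemma le_max_int (S : int -> Prop) a b : S a -> (forall k, S k -> k <= b) -> a <= max_int S.
Proof.
move=> Sa Sb.
(* The maximum is an element at the least distance from the bound [b]. *)
have exn : exists j, `[< exists2 c, S c & j%:Z = b - c >].
  exists `|b - a|%N; apply/asboolP; exists a => //.
  by rewrite gez0_abs // subr_ge0 Sb.
have [j /asboolP[c Sc jE] jmin] := ex_minnP exn.
have cmax k : S k -> k <= c.
  move=> Sk; have h := jmin `|b - k|%N.
  have : (j <= `|b - k|)%N.
    by apply: h; apply/asboolP; exists k => //; rewrite gez0_abs // subr_ge0 Sb.
  have : 0 <= b - k by rewrite subr_ge0 Sb.
  move: (Sb _ Sk); lia.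
by rewrite (max_int_eq Sc cmax) cmax.
Qed.

Lemma face_card_le_krull_dim (K : fieldType) n (D : simplicial_complex n) F :
  F \in faces D -> #|F|%:Z <= krull_dim (SR_ring K D).
Proof.
move=> /(face_chain K)[P Pchain]; apply: (@le_max_int _ _ n%:Z).
  by exists #|F|, P.
move=> k [d [Q [Qchain ->]]]; have := prime_chain_length Qchain.
by rewrite lez_nat.
Qed.

(** * The resolutions of the Stanley-Reisner ring and ideal *)

(** Regularity and degree resolutions depend only on which Betti numbers vanish, so it suffices to
    compare the sets of generator degrees of [F] and of the resolution chosen in [betti]. *)
Lemma betti_neq0 (K : fieldType) n (M : lmodType {mpoly K[n]}) (hom : nat -> M -> Prop)
    part (F : free_complex M) i j :
  grading_projection hom part -> min_graded_resolution hom F ->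
  betti hom i j <> 0%N <-> exists c : 'I_(rk F i), dg c = j.
Proof.
move=> gp Fmin; rewrite /betti; case: pselect => [ex|]; last by case; exists F.
case: cid => G /= Gmin; have [[Fg Fr _] [Gg Gr _]] := (Fmin, Gmin).
split=> [/eqP|[c <-]].
  rewrite -lt0n => /card_gt0P[r]; rewrite inE => /eqP <-.
  exact: (minimal_generator_degree gp _ Gmin).
have [r rc] := minimal_generator_degree gp c Fmin Gg Gr.
by apply/eqP; rewrite -lt0n; apply/card_gt0P; exists r; rewrite inE rc.
Qed.

(** * Monomial generators and the degree of the ideal *)

Section MonomialIdeals.
Variables (K : fieldType) (n : nat).
Local Notation R := {mpoly K[n]}.

Definition monomials (G : 'X_{1..n} -> Prop) (p : R) := exists2 m, G m & p = 'X_[m].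

Lemma mem_ideal_gen (S : R -> Prop) p : S p -> p \in ideal_gen S.
Proof.
move=> Sp; apply/asboolP; exists [:: (1, p)]; rewrite big_seq1 mul1r.
by split=> // g; rewrite inE => /eqP->.
Qed.

Lemma monomial_in_ideal_gen G m :
  'X_[m] \in ideal_gen (monomials G) -> exists2 g, G g & (g <= m)%MM.
Proof.
move=> /asboolP[s [sG mE]]; apply: contrapT => noG.
have /eqP : ('X_[m] : R)@_m = 0.
  rewrite mE raddf_sum big_seq big1 //= => g /sG[a Ga ->].
  by rewrite mcoeffMX_if; case: ifP => // am; case: noG; exists a.
by rewrite mcoeffX eqxx oner_eq0.
Qed.

End MonomialIdeals.

Section StanleyReisner.
Variables (K : fieldType) (n : nat) (D : simplicial_complex n).
Local Notation R := {mpoly K[n]}.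
Local Notation I := (SR_ideal K D).

Definition minimal_nonface (N : {set 'I_n}) := minset (fun A => A \notin faces D) N.

Lemma minimal_nonface_sub (A : {set 'I_n}) : A \notin faces D ->
  exists2 N, minimal_nonface N & N \subset A.
Proof. by move=> /(minset_exists (P := fun A => A \notin faces D))[N]; exists N. Qed.

Lemma minimal_nonface_eq (N N' : {set 'I_n}) :
  minimal_nonface N -> minimal_nonface N' -> N' \subset N -> N' = N.
Proof. by move=> /minsetP[_ Nmin] /minsetP[N'n _]; apply: Nmin. Qed.

Definition SR_gens (m : 'X_{1..n}) : Prop := exists2 N, minimal_nonface N & m = mset N.

Lemma SR_generates : generates SR_gens I.
Proof.
move=> p; congr (p \in ideal_gen _); apply: funext => q; apply: propext.
split=> [[N NN ->]|[m [N NN ->] ->]]; last by exists N => //; rewrite prodX_mset.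
by exists (mset N); [exists N | rewrite prodX_mset].
Qed.

(** Some [g] in [G] divides the monomial of [N], and the monomial of some minimal nonface [N']
    divides [g]. Then [N'] lies in [N], so all three agree. *)
Lemma SR_generator_minimal (G : 'X_{1..n} -> Prop) N :
  generates G I -> minimal_nonface N -> G (mset N).
Proof.
move=> GI NN; have : 'X_[mset N] \in I.
  by rewrite SR_generates; apply: mem_ideal_gen; exists (mset N) => //; exists N.
rewrite GI => /monomial_in_ideal_gen[g Gg gN].
have : 'X_[g] \in I by rewrite GI; apply: mem_ideal_gen; exists g.
rewrite SR_generates => /monomial_in_ideal_gen[_ [N' NN' ->] N'g].
have N'N : N' = N.
  by apply: minimal_nonface_eq => //; rewrite -mset_le_mset (lepm_trans N'g).
suff <- : g = mset N by [].
rewrite N'N in N'g; apply/mnmP=> i; apply/eqP; rewrite eqn_leq.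
by rewrite (mnm_lepP gN) (mnm_lepP N'g).
Qed.

Lemma min_monomial_gensE G m : min_monomial_gens G I -> G m -> SR_gens m.
Proof.
move=> [GI Gmin] Gm; apply: (Gmin SR_gens) => //; last exact: SR_generates.
by move=> _ [N NN ->]; apply: SR_generator_minimal.
Qed.

Lemma SR_gens_minimal : min_monomial_gens SR_gens I.
Proof.
split=> [|G _ GI _ [N NN ->]]; first exact: SR_generates.
exact: SR_generator_minimal.
Qed.

Lemma omega_eq N : minimal_nonface N ->
  (forall N', minimal_nonface N' -> (#|N'| <= #|N|)%N) -> omega I = #|N|%:Z.
Proof.
move=> NN Nmax; apply: max_int_eq.
  exists SR_gens, (mset N); split; [exact: SR_gens_minimal|by exists N|].
  by rewrite mdeg_mset.
move=> _ [G [m [GI Gm ->]]].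
have [N' NN' ->] := min_monomial_gensE GI Gm.
by rewrite mdeg_mset lez_nat Nmax.
Qed.

Lemma omega_simplex : (forall A, A \in faces D) -> omega I = 0.
Proof.
move=> DT; apply: max_int0 => _ [G [m [GI Gm _]]].
by have [N /minsetP[]] := min_monomial_gensE GI Gm; rewrite DT.
Qed.

Lemma pihomogM_shifted d e (p q : R) : q \is e.-homog ->
  pihomog mdeg d (p * q) = shifted_part d e p * q.
Proof.
move=> hq; rewrite -(@shifted_part_mul _ _ d e 0); first by rewrite /shifted_part subn0.
by split; rewrite ?ltn0 ?subn0.
Qed.

Lemma SR_homogeneous d p : p \in I -> pihomog mdeg d p \in I.
Proof.
rewrite SR_generates => /asboolP[s [sG ->]].
rewrite raddf_sum big_seq; apply: (rpred_sum (S := I)) => g /sG[m Gm ->] /=.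
rewrite (@pihomogM_shifted d (mdeg m)) ?dhomogX //.
apply: (idealMr (idealrI := I)); rewrite SR_generates; apply: mem_ideal_gen.
by exists m.
Qed.

(** Computed on a representative; the choice does not matter because the ideal is homogeneous. *)
Definition quot_part d (x : quot_mod I) : quot_mod I :=
  \pi_({ideal_quot I}) (pihomog mdeg d (repr x)).

Lemma quot_partE d p :
  quot_part d (\pi_({ideal_quot I}) p) = \pi_({ideal_quot I}) (pihomog mdeg d p).
Proof.
rewrite /quot_part; apply/eqP; rewrite -Quotient.idealrBE -raddfB /=.
by apply: SR_homogeneous; rewrite Quotient.idealrBE reprK.
Qed.

Lemma quot_modP (x : quot_mod I) : exists p, x = \pi_({ideal_quot I}) p.
Proof. by exists (repr x); rewrite reprK. Qed.

Lemma quot_grading : grading_projection (@quot_hom K n I) quot_part.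
Proof.
move=> d; split=> [x y|e p x [q hq ->]].
  have [p ->] := quot_modP x; have [q ->] := quot_modP y.
  have -> : \pi_({ideal_quot I}) p + \pi_({ideal_quot I}) q = \pi_({ideal_quot I}) (p + q) :> quot_mod I.
    by rewrite rmorphD.
  by rewrite !quot_partE raddfD rmorphD.
have scaleE a b : a *: (\pi_({ideal_quot I}) b : quot_mod I) = \pi_({ideal_quot I}) (a * b).
  by rewrite rmorphM.
by rewrite !scaleE quot_partE (pihomogM_shifted _ _ hq).
Qed.

Fact ideal_part_subproof d (x : ideal_mod I) : pihomog mdeg d (val x : R) \in ideal_pred I.
Proof. exact: SR_homogeneous (valP x). Qed.
Definition ideal_part d (x : ideal_mod I) : ideal_mod I :=
  exist _ (pihomog mdeg d (val x : R)) (ideal_part_subproof d x).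

Lemma ideal_grading : grading_projection (@ideal_hom K n I) ideal_part.
Proof.
move=> d; split=> [x y|e p x hx]; apply: val_inj.
  by rewrite /= raddfD.
exact: pihomogM_shifted.
Qed.


(** * The squarefree resolution *)

Definition nonfaces := [set N : {set 'I_n} | minset (fun A => A \notin faces D) N].
Definition nonface_set (r : 'I_#|nonfaces|) : {set 'I_n} := enum_val r.

Lemma nonface_setP r : minimal_nonface (nonface_set r).
Proof. by have := enum_valP r; rewrite inE. Qed.

Lemma minimal_nonface_row N : minimal_nonface N -> exists r, nonface_set r = N.
Proof.
move=> NN; have Nin : N \in nonfaces by rewrite inE.
by exists (enum_rank_in Nin N); rewrite /nonface_set enum_rankK_in.
Qed.

(** Minimal nonfaces are pairwise incomparable, so a row within the label of [r] is supported on [r]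
    alone. *)
Lemma nonface_irredundant :
  irredundant nonface_set (const_mx 1 : 'M[K]_(#|nonfaces|, 1)).
Proof.
move=> A t tA t0 r rA; have /rowP/(_ 0) := t0; rewrite !mxE (bigD1 r) //= big1 => [|s sr].
  by rewrite mxE mulr1 addr0.
have [->|/tA] := eqVneq (t 0 s) 0; first by rewrite mul0r.
rewrite -rA => /(minimal_nonface_eq (nonface_setP r) (nonface_setP s)).
by move/enum_val_inj/eqP; rewrite (negPf sr).
Qed.

(** One differential with the labels of both its ends. The columns of the next stage are by
    definition the rows of this one, so the types of consecutive matrices match without casts. *)
Record stage := Stage {
  col_num : nat; col_set : 'I_col_num -> {set 'I_n};
  row_num : nat; row_set : 'I_row_num -> {set 'I_n};
  stage_mx : 'M[K]_(row_num, col_num);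
  stage_irr : irredundant row_set stage_mx
}.

Definition first_stage : stage :=
  @Stage 1 (fun=> set0) _ _ _ nonface_irredundant.

Definition next_stage (s : stage) : stage :=
  let k' := cid (exists_irredundant_syzygies (@row_set s) (stage_mx s)) in
  let W' := cid (projT2 k') in
  let C := cid (projT2 W') in
  @Stage _ (@row_set s) (projT1 k') (projT1 W') (projT1 C) (projT2 C).2.

Fixpoint stages i : stage := if i is j.+1 then next_stage (stages j) else first_stage.

Definition res_rk i : nat := col_num (stages i).
Definition res_set i : 'I_(res_rk i) -> {set 'I_n} := @col_set (stages i).
Definition res_mx i : 'M[K]_(res_rk i.+1, res_rk i) := stage_mx (stages i).

Lemma res_irr i : irredundant (@res_set i.+1) (res_mx i).
Proof. exact: stage_irr. Qed.

Lemma res_syzygies i :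
  syzygies (@res_set i.+1) (@res_set i.+2) (res_mx i.+1) (res_mx i).
Proof.
exact: (projT2 (cid (projT2 (cid (projT2 (cid (exists_irredundant_syzygies
  (@row_set (stages i)) (stage_mx (stages i))))))))).1.
Qed.

Lemma res_downward i : downward (@res_set i) (@res_set i.+1) (res_mx i).
Proof. by case: i => [r c _|i]; [apply: sub0set | have [] := res_syzygies i]. Qed.

Lemma minimal_nonface_neq0 N : minimal_nonface N -> N != set0.
Proof. by case/minsetP=> + _; apply: contraNneq => ->; apply: faces0. Qed.

(** Row [r] of a differential is a relation, within the label of [r], among the rows of the
    preceding one; irredundancy kills its coefficients at equal labels. In position 0 the label is
    empty, whereas minimal nonfaces are not. *)
Lemma res_minimal i r c : @res_set i c = @res_set i.+1 r -> res_mx i r c = 0.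
Proof.
case: i r c => [r c e|i r c e].
  by have := minimal_nonface_neq0 (nonface_setP r); rewrite -[nonface_set r]e eqxx.
have [Cd CC _] := res_syzygies i.
have rW : row_within (@res_set i.+1) (@res_set i.+2 r) (row r (res_mx i.+1)).
  by move=> c'; rewrite mxE; apply: Cd.
have := res_irr rW; rewrite -row_mul CC row0 => /(_ erefl c e).
by rewrite mxE.
Qed.

Lemma res_surj A (u : 'rV[K]_(res_rk 0)) : A \notin faces D -> row_within (@res_set 0) A u ->
  exists2 w, row_within (@res_set 1) A w & u = w *m res_mx 0.
Proof.
case/minimal_nonface_sub=> N /minimal_nonface_row[r <-] NA _.
exists (u 0 0 *: delta_mx 0 r).
  move=> s; rewrite !mxE; case: (s =P r) => [->|]; first by rewrite mulr1.
  by rewrite andbF mulr0 eqxx.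
by rewrite -scalemxAl -rowE; apply/rowP=> c; rewrite !mxE mulr1 [c]ord1.
Qed.

Lemma res_degree i (r : 'I_(res_rk i)) e : (forall F, F \in faces D -> (#|F| <= e)%N) ->
  (#|res_set r| <= i + e)%N.
Proof.
move=> De; have [S [Sr Si /negP]] :=
  minimal_generator_face res_syzygies (@res_downward 0) res_surj res_minimal r.
rewrite negbK => /De; rewrite cardsD (setIidPr Sr) Si.
by rewrite leq_subLR.
Qed.

Definition res_df i : 'M[R]_(res_rk i.+1, res_rk i) :=
  lift_mx (@res_set i) (@res_set i.+1) (res_mx i).

Definition SR_resolution : free_complex (quot_mod I) :=
  @FreeComplex K n (quot_mod I) res_rk (fun i r => #|@res_set i r|) res_df
    (fun=> \pi_({ideal_quot I}) 1).

Lemma res_df0 r c : res_df 0 r c = 'X_[mset (nonface_set r)].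
Proof.
rewrite mxE [res_mx 0 r c]mxE scale1r; congr mpolyX.
by apply/mnmP=> i; rewrite mnmBE !mnmE inE subn0.
Qed.

Lemma aug_SR_resolution (v : 'rV_(res_rk 0)) :
  @aug_map _ _ _ SR_resolution v = \pi_({ideal_quot I}) (v 0 0).
Proof.
rewrite /aug_map /= big_ord_recl big_ord0 addr0.
have -> : v ord0 ord0 = v 0 0 by [].
by rewrite -[v 0 0 in RHS]mulr1 rmorphM.
Qed.

Lemma mem_SR_row p : p \in I <-> exists w : 'rV_(res_rk 1), p = (w *m res_df 0) 0 0.
Proof.
split=> [|[w ->]]; last first.
  rewrite mxE; apply: (rpred_sum (S := I)) => r _; rewrite res_df0.
  apply: (idealMr (idealrI := I)); rewrite SR_generates; apply: mem_ideal_gen.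
  exists (mset (nonface_set r)) => //; exists (nonface_set r) => //; exact: nonface_setP.
rewrite SR_generates => /asboolP[s [sG ->]].
elim: s sG => [|g s IH] sG; first by exists 0; rewrite mul0mx mxE big_nil.
have [h hs|w wE] := IH; first by apply: sG; rewrite inE hs orbT.
have [|_ [N NN ->] gE] := sG g; first by rewrite inE eqxx.
have [r rN] := minimal_nonface_row NN.
exists (g.1 *: delta_mx 0 r + w); rewrite big_cons wE mulmxDl [RHS]mxE; congr (_ + _).
rewrite -scalemxAl -rowE mxE; congr (_ * _).
by rewrite mxE res_df0 rN gE.
Qed.

Lemma res_df_exact i (v : 'rV_(res_rk i.+1)) :
  v *m res_df i = 0 <-> exists w, v = w *m res_df i.+1.
Proof. exact: lift_mx_exact (@res_downward i) (res_syzygies i). Qed.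

Lemma pi_quot_eq0 p : \pi_({ideal_quot I}) p = 0 :> quot_mod I <-> p \in I.
Proof.
have -> : (p \in I) = (p - 0 \in I) by rewrite subr0.
rewrite Quotient.idealrBE; have -> : (0 : quot_mod I) = \pi_({ideal_quot I}) 0 by rewrite rmorph0.
by split=> /eqP.
Qed.

Lemma SR_resolution_minimal : min_graded_resolution (@quot_hom K n I) SR_resolution.
Proof.
split; last by move=> i r c; apply: lift_mx_minimal => [|/res_minimal]; first exact: res_downward.
  split=> [c|i r c]; last exact/lift_mx_graded/res_downward.
  by exists 1 => //=; rewrite cards0 dhomog1.
split=> [x|v|i v]; last exact: res_df_exact.
  have [p ->] := quot_modP x; exists (const_mx p).
  by rewrite aug_SR_resolution mxE.
rewrite aug_SR_resolution pi_quot_eq0 mem_SR_row.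
split=> -[w E]; exists w; last by rewrite E.
by apply/rowP=> c; rewrite [c]ord1.
Qed.

Lemma res_df0_mem r : (res_df 0 r 0 : R^o) \in ideal_pred I.
Proof. by apply/mem_SR_row; exists (delta_mx 0 r); rewrite -rowE [RHS]mxE. Qed.

(** Positions drop by one and degrees are kept, so position [i] here is position [i.+1] of
    [SR_resolution]. *)
Definition SR_ideal_resolution : free_complex (ideal_mod I) :=
  @FreeComplex K n (ideal_mod I) (fun i => res_rk i.+1) (fun i r => #|@res_set i.+1 r|)
    (fun i => res_df i.+1) (fun r => exist _ (res_df 0 r 0 : R^o) (res_df0_mem r)).

Lemma val_aug_SR_ideal_resolution (v : 'rV_(res_rk 1)) :
  val (@aug_map _ _ _ SR_ideal_resolution v) = (v *m res_df 0) 0 0.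
Proof. by rewrite /aug_map raddf_sum mxE. Qed.

Lemma SR_ideal_resolution_minimal :
  min_graded_resolution (@ideal_hom K n I) SR_ideal_resolution.
Proof.
split; last by move=> i r c; apply: lift_mx_minimal => [|/res_minimal]; first exact: res_downward.
  split=> [c|i r c]; last exact/lift_mx_graded/res_downward.
  by rewrite /ideal_hom /= res_df0 dhomogX /= mdeg_mset.
split=> [x|v|i v]; last exact: res_df_exact.
  have /mem_SR_row[w xE] := valP x; exists w; apply: val_inj.
  by rewrite val_aug_SR_ideal_resolution -xE.
rewrite -res_df_exact; split=> [v0|v0].
  by apply/rowP=> c; rewrite [c]ord1 -val_aug_SR_ideal_resolution v0 mxE.
by apply: val_inj; rewrite val_aug_SR_ideal_resolution v0 mxE.
Qed.

(** * Betti numbers and regularity *)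

Lemma betti_quot_neq0 i j : betti (@quot_hom K n I) i j <> 0%N <->
  exists c : 'I_(res_rk i), #|res_set c| = j.
Proof. exact: (betti_neq0 _ _ (@quot_grading) SR_resolution_minimal). Qed.

Lemma betti_ideal_neq0 i j : betti (@ideal_hom K n I) i j <> 0%N <->
  exists c : 'I_(res_rk i.+1), #|res_set c| = j.
Proof. exact: (betti_neq0 _ _ (@ideal_grading) SR_ideal_resolution_minimal). Qed.

Lemma betti_quot0 : betti (@quot_hom K n I) 0 0 <> 0%N.
Proof. by apply/betti_quot_neq0; exists ord0; rewrite cards0. Qed.

(** Without nonfaces the first differential has no rows. Above it, any row over zero columns would
    be a relation by itself, which irredundancy forbids. *)
Lemma res_rk_simplex i : (forall A, A \in faces D) -> res_rk i.+1 = 0%N.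
Proof.
move=> DT; elim: i => [|i IH].
  by apply/eqP; rewrite cards_eq0; apply/eqP/setP=> N; rewrite !inE; apply/minsetP=> -[]; rewrite DT.
apply/eqP; rewrite -leqn0 leqNgt; apply/negP => pos.
pose r := Ordinal pos.
have rW : row_within (@res_set i.+2) (res_set r) (delta_mx 0 r : 'rV[K]_(res_rk i.+2)).
  by move=> s; rewrite mxE eqxx /=; case: (s =P r) => [->|]; rewrite ?eqxx.
have rC : delta_mx 0 r *m res_mx i.+1 = 0 :> 'rV[K]_(res_rk i.+1).
  by apply/rowP=> c; have := ltn_ord c; rewrite [X in (_ < X)%N]IH.
by have /eqP := res_irr rW rC erefl; rewrite mxE !eqxx oner_eq0.
Qed.

Lemma SR_reg_simplex : (forall A, A \in faces D) -> SR_reg K D = 0.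
Proof.
move=> DT; apply: max_int_eq; first by exists 0, 0; split; first exact: betti_quot0.
move=> _ [[|i] [j [/betti_quot_neq0[c <-] ->]]]; first by rewrite cards0.
by have := ltn_ord c; rewrite [X in (_ < X)%N](res_rk_simplex _ DT).
Qed.

Lemma SR_reg_eq N : minimal_nonface N ->
  (forall i j, betti (@quot_hom K n I) i j <> 0%N -> (j < i + #|N|)%N) ->
  SR_reg K D = #|N|%:Z - 1.
Proof.
move=> NN bound; apply: max_int_eq.
  exists 1, #|N|; split=> //; apply/betti_quot_neq0.
  by have [r rN] := minimal_nonface_row NN; exists r; rewrite -rN.
by move=> _ [i [j [/bound + ->]]]; lia.
Qed.

End StanleyReisner.

(** * Dimension against degree and regularity *)

Theorem lemma3p6 (K : fieldType) (n : nat) (hn : (0 < n)%N)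
    (D : simplicial_complex n) :
  krull_dim (SR_ring K D) >= omega (SR_ideal K D) - 1 /\
  (krull_dim (SR_ring K D) = omega (SR_ideal K D) - 1 <->
   degree_resolution (SR_ideal K D) /\
   SR_reg K D = krull_dim (SR_ring K D)).
Proof.
have face_le F : F \in faces D -> #|F|%:Z <= krull_dim (SR_ring K D).
  exact: face_card_le_krull_dim.
(* For the full simplex the degree and the regularity are 0, while the dimension is at least
   [n > 0]: both sides of the equivalence fail. *)
have [/forallP DT|/forallPn[A AD]] := boolP [forall A, A \in faces D].
  have := face_le _ (DT setT); rewrite cardsT card_ord => nk.
  rewrite omega_simplex // SR_reg_simplex //; split; first by lia.
  by split=> [|[_]]; lia.
have [N0 NN0 _] := minimal_nonface_sub AD.
have [N NN Nmax] := arg_maxnP (fun N : {set 'I_n} => #|N|) NN0.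
rewrite (omega_eq K NN Nmax).
have [x xN] : exists x, x \in N by apply/set0Pn/(minimal_nonface_neq0 NN).
have N1 : (0 < #|N|)%N by apply/card_gt0P; exists x.
have dimN : #|N|%:Z - 1 <= krull_dim (SR_ring K D).
  have NxD : N :\ x \in faces D.
    apply: contraT => NxD; have [N' NN' N'x] := minimal_nonface_sub NxD.
    have N'N : N' = N.
      by apply: minimal_nonface_eq NN NN' (subset_trans N'x (subD1set _ _)).
    by move: N'x; rewrite N'N => /subsetP/(_ x xN); rewrite !inE eqxx.
  by have := face_le _ NxD; rewrite (cardsD1 x N) xN; lia.
split=> //; split=> [dimE|[deg <-]]; last first.
  rewrite (SR_reg_eq NN) // => i j /betti_quot_neq0[c cj].
  (* Position 0 has only degree 0, which is below the size of [N]; position [i.+1] is position [i]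
     of the ideal, where the degree resolution applies. *)
  case: i c cj => [|i] c cj; first by rewrite -cj cards0.
  rewrite addSn ltnS leqNgt; apply/negP => Nj.
  suff : betti (@ideal_hom K n (SR_ideal K D)) i j <> 0%N.
    by apply; apply: deg; rewrite (omega_eq K NN Nmax); lia.
  by apply/betti_ideal_neq0; exists c.
(* Faces bound the dimension from below, so they have at most [#|N| - 1] elements. By [res_degree],
   position [i.+1] then has degrees at most [i + #|N|]. *)
have De F : F \in faces D -> (#|F| <= #|N|.-1)%N.
  move=> /face_le; rewrite dimE; lia.
split=> [i j ij|].
  apply: contrapT => /betti_ideal_neq0[c cj].
  have := res_degree c De; rewrite cj; move: ij.
  by rewrite (omega_eq K NN Nmax); lia.
rewrite (SR_reg_eq NN) ?dimE // => i j /betti_quot_neq0[c <-].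
by have := res_degree c De; lia.
Qed.
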